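(* Let $X$, $Y$, $Z$ be Hilbert spaces and consider either of the following two settings. Case $i=0$: $\mathcal{L}:X\to Y$ is a bounded linear operator with $\mathcal{L}=\mathcal{P}\mathcal{Q}$, where $\mathcal{P}:Z\to Y$ and $\mathcal{Q}:X\to Z$ are bounded linear operators and there is a constant $c>0$ such that $c\|z\|_Z\leq\|\mathcal{P}z\|_Y$ for every $z\in Z$. Set $\mathcal{K}^{(0)}g:=\|\mathcal{L}g\|_Y$ for $g\in X$. Case $i=1$: $\mathcal{L}:X\to X$ is a bounded linear operator with $\mathcal{L}=\mathcal{Q}^*\mathcal{A}\mathcal{Q}$, where $\mathcal{Q}:X\to Z$ and $\mathcal{A}:Z\to Z$ are bounded linear operators and there is a constant $c>0$ such that $c\|z\|_Z^2\leq|(z,\mathcal{A}z)_Z|$ for every $z\in\mathcal{R}(\mathcal{Q})\subseteq Z$. Set $\mathcal{K}^{(1)}g:=|(\mathcal{L}^*g,g)_X|^2$ for $g\in X$. Then, for $i=0$ (respectively $i=1$) and every nonzero $\varphi\in X$, the following are equivalent: (a) $\varphi\in\mathcal{R}(\mathcal{Q}^* )$; (b) for all subsets $\chi\subseteq\mathcal{P}_\varphi:=\{h\in X\,:\,(h,\varphi)_X=0\}$, $$\mathcal{I}^{(i)}_\chi(\varphi):=\inf_{h\in\chi}\left\{\mathcal{K}^{(i)}(\hat{\varphi}+h)\right\}>0.$$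
   Context: $\mathcal{R}(\cdot)$ denotes the range of an operator, ${}^*$ the Hilbert space adjoint, and $\hat{\varphi}:=\varphi/\|\varphi\|_X$. The set $\mathcal{P}_\varphi$ is not to be confused with the operator $\mathcal{P}$. Infima are taken in the extended reals, with $\inf\emptyset=+\infty$. *)

(* Defs.v *)
From HB Require Import structures.
From mathcomp Require Import all_boot all_order all_algebra.
From mathcomp Require Import sesquilinear complex.
From mathcomp Require Import all_classical all_reals all_analysis.

Set Implicit Arguments.
Unset Strict Implicit.
Unset Printing Implicit Defensive.

Import Order.TTheory GRing.Theory Num.Theory.
Import numFieldNormedType.Exports.

Local Open Scope classical_set_scope.
Local Open Scope ring_scope.

(* Hilbert spaces are taken over either the reals or the complex numbers; the
   tag [k] selects which, so that statements quantified over it cover both. *)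
Inductive scalar_kind := RealScalars | ComplexScalars.

Definition scalars (R : realType) (k : scalar_kind) : numFieldType :=
  match k with
  | RealScalars => R : numFieldType
  | ComplexScalars => R[i] : numFieldType
  end.

Definition conj_scalar (R : realType) (k : scalar_kind) :
    scalars R k -> scalars R k :=
  match k return scalars R k -> scalars R k with
  | RealScalars => fun a => a
  | ComplexScalars => fun a : R[i] => a^*%C
  end.

Definition re_scalar (R : realType) (k : scalar_kind) : scalars R k -> R :=
  match k return scalars R k -> R with
  | RealScalars => fun a => a
  | ComplexScalars => fun a : R[i] => complex.Re a
  end.

Section ConjScalar.
Variables (R : realType) (k : scalar_kind).

Lemma conj_scalar_is_zmod_morphism : zmod_morphism (@conj_scalar R k).
Proof. by case: k => // a b; rewrite /conj_scalar rmorphB. Qed.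

Lemma conj_scalar_is_monoid_morphism : monoid_morphism (@conj_scalar R k).
Proof.
by case: k; split=> // [|a b]; rewrite /conj_scalar ?rmorph1 ?rmorphM.
Qed.

Lemma conj_scalarK : involutive (@conj_scalar R k).
Proof. by case: k => // a; exact: conjcK. Qed.

HB.instance Definition _ :=
  GRing.isZmodMorphism.Build (scalars R k) (scalars R k) (@conj_scalar R k)
    conj_scalar_is_zmod_morphism.
HB.instance Definition _ :=
  GRing.isMonoidMorphism.Build (scalars R k) (scalars R k) (@conj_scalar R k)
    conj_scalar_is_monoid_morphism.
HB.instance Definition _ :=
  isInvolutive.Build (scalars R k) (@conj_scalar R k) conj_scalarK.

End ConjScalar.

(* The inner product [hdot] is linear in its first argument and
   conjugate-linear in its second. *)
HB.mixin Record CompleteNormedModule_isHilbert (R : realType) (k : scalar_kind)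
    X of CompleteNormedModule (scalars R k) X := {
  hdot : {dot X for @conj_scalar R k};
  hnormE : forall x : X, `|x| ^+ 2 = hdot x x
}.

#[short(type="hilbertType")]
HB.structure Definition Hilbert (R : realType) (k : scalar_kind) :=
  { X of CompleteNormedModule_isHilbert R k X &
         CompleteNormedModule (scalars R k) X }.

(* MathComp norms take values in the scalar field; these are the same norms
   read as elements of [R]. *)
Definition rnorm (R : realType) (k : scalar_kind)
    (V : normedModType (scalars R k)) (x : V) : R := re_scalar `|x|.

Definition rabs (R : realType) (k : scalar_kind) (a : scalars R k) : R :=
  re_scalar `|a|.

Section Operators.
Variables (R : realType) (k : scalar_kind).

Definition bounded_operator (X Y : hilbertType R k) (T : X -> Y) : Prop :=
  exists M : R, forall x, rnorm (T x) <= M * rnorm x.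

(* For a bounded linear [T] the vector selected here exists, by the Riesz
   representation theorem, and is unique; the default 0 is then never used. *)
Definition adjoint (X Y : hilbertType R k) (T : X -> Y) (y : Y) : X :=
  xget 0 [set x | forall u, hdot (T u) y = hdot u x].

Definition hat (X : hilbertType R k) (phi : X) : X := `|phi|^-1 *: phi.

Definition orth (X : hilbertType R k) (phi : X) : set X :=
  [set h | hdot h phi = 0].

Definition K0 (X Y : hilbertType R k) (L : X -> Y) (g : X) : R := rnorm (L g).

Definition K1 (X : hilbertType R k) (L : X -> X) (g : X) : R :=
  rabs (hdot (adjoint L g) g) ^+ 2.

Definition inf_test (X : hilbertType R k) (K : X -> R) (chi : set X) (phi : X) :
    \bar R :=
  ereal_inf [set (K (hat phi + h))%:E | h in chi].

End Operators.

(* Main.v *)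
Require Import Defs.
From HB Require Import structures.
From mathcomp Require Import all_boot all_order all_algebra.
From mathcomp Require Import sesquilinear complex.
From mathcomp Require Import all_classical all_reals all_analysis.
From mathcomp Require Import ring lra.

Import Order.TTheory GRing.Theory Num.Theory.
Import numFieldNormedType.Exports.

Local Open Scope classical_set_scope.
Local Open Scope ring_scope.

(** Both tests are comparable to a power of [rnorm (Q g)]. By homogeneity, a
    positive infimum over the hyperplane [hat phi + orth phi] amounts to a bound
    [rabs (hdot g phi) <= C * rnorm (Q g)], which says that [hdot g phi] is a
    bounded linear functional of [Q g]; the vector representing it is a preimage
    of [phi] under the adjoint of [Q]. *)

(** * Real-valued norms and moduli *)

Section Scalars.
Context {R : realType} {k : scalar_kind}.
Implicit Types (a b : scalars R k) (r s : R).

(** Identities and inequalities between real norms are transported along this embedding into the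
    scalar field, where the norm and inner product axioms are stated. *)
Definition of_real : R -> scalars R k :=
  match k return R -> scalars R k with
  | RealScalars => fun r => r
  | ComplexScalars => fun r => r%:C%C
  end.

Lemma of_real_is_zmod_morphism : zmod_morphism of_real.
Proof. by rewrite /of_real; case: k => // r s; rewrite rmorphB. Qed.

Lemma of_real_is_monoid_morphism : monoid_morphism of_real.
Proof.
by rewrite /of_real; case: k; split=> // r s; rewrite rmorphM.
Qed.

HB.instance Definition _ :=
  GRing.isZmodMorphism.Build R (scalars R k) of_real of_real_is_zmod_morphism.
HB.instance Definition _ :=
  GRing.isMonoidMorphism.Build R (scalars R k) of_real
    of_real_is_monoid_morphism.

Lemma ler_of_real r s : (of_real r <= of_real s) = (r <= s).
Proof. by rewrite /of_real; case: k => //; rewrite lecR. Qed.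

Lemma ltr_of_real r s : (of_real r < of_real s) = (r < s).
Proof. by rewrite /of_real; case: k => //; rewrite ltcR. Qed.

Lemma of_real_inj : injective of_real.
Proof. by rewrite /of_real; case: k => // r s []. Qed.

Lemma re_scalarK a : 0 <= a -> of_real (re_scalar a) = a.
Proof.
rewrite /of_real /re_scalar; case: k a => // a a0.
by rewrite RRe_real// ger0_real.
Qed.

Lemma mulr_conj a : a * conj_scalar a = `|a| ^+ 2.
Proof.
rewrite /conj_scalar; case: k a => a; last by rewrite sqr_normc.
by rewrite real_normK ?num_real// expr2.
Qed.

Lemma of_real_rabs a : of_real (rabs a) = `|a|.
Proof. exact: re_scalarK. Qed.

Lemma of_real_rnorm (V : normedModType (scalars R k)) (x : V) :
  of_real (rnorm x) = `|x|.
Proof. exact: re_scalarK. Qed.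

Lemma rabs_ge0 a : 0 <= rabs a.
Proof. by rewrite -ler_of_real of_real_rabs rmorph0. Qed.

Lemma rabs0 : rabs (0 : scalars R k) = 0.
Proof. by apply: of_real_inj; rewrite of_real_rabs normr0 rmorph0. Qed.

Lemma rabs1 : rabs (1 : scalars R k) = 1.
Proof. by apply: of_real_inj; rewrite of_real_rabs normr1 rmorph1. Qed.

Lemma rabs_le0 a : (rabs a <= 0) = (a == 0).
Proof. by rewrite -ler_of_real of_real_rabs rmorph0 normr_le0. Qed.

Lemma rabsM a b : rabs (a * b) = rabs a * rabs b.
Proof. by apply: of_real_inj; rewrite rmorphM/= !of_real_rabs normrM. Qed.

Lemma ler_rabsD a b : rabs (a + b) <= rabs a + rabs b.
Proof. by rewrite -ler_of_real rmorphD/= !of_real_rabs ler_normD. Qed.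

Lemma rabs_conj a : rabs (conj_scalar a) = rabs a.
Proof.
apply: of_real_inj; rewrite !of_real_rabs /conj_scalar.
by case: k a => // a; rewrite normcJ.
Qed.

Variable V : normedModType (scalars R k).
Implicit Types x y : V.

Lemma rnorm_ge0 x : 0 <= rnorm x.
Proof. by rewrite -ler_of_real of_real_rnorm rmorph0. Qed.

Lemma rnorm0 : rnorm (0 : V) = 0.
Proof. by apply: of_real_inj; rewrite of_real_rnorm normr0 rmorph0. Qed.

Lemma rnorm_le0 x : (rnorm x <= 0) = (x == 0).
Proof. by rewrite -ler_of_real of_real_rnorm rmorph0 normr_le0. Qed.

Lemma rnorm_gt0 x : (0 < rnorm x) = (x != 0).
Proof. by rewrite ltNge rnorm_le0. Qed.

Lemma rnormZ a x : rnorm (a *: x) = rabs a * rnorm x.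
Proof.
by apply: of_real_inj; rewrite rmorphM/= of_real_rabs !of_real_rnorm normrZ.
Qed.

Lemma rnormN x : rnorm (- x) = rnorm x.
Proof. by rewrite /rnorm normrN. Qed.

End Scalars.
Arguments of_real_inj {R k}.

(** * Completeness in terms of real norms *)

Section Completeness.
Context {R : realType} {k : scalar_kind}.
Context {V : completeNormedModType (scalars R k)}.

(** The rate makes [u] Cauchy, so completeness gives a limit. Convergence is phrased with [rnorm] so
    that later limits are taken in [R]. *)
Lemma cvg_of_rate (u : nat -> V) (h : nat -> R) : h @ \oo --> (0 : R) ->
  (forall n m, rnorm (u n - u m) <= h n + h m) ->
  exists w, rnorm (w - u n) @[n --> \oo] --> (0 : R).
Proof.
move=> h0 uh; have ucvg : cvg (u @ \oo).
  apply/cauchy_cvgP/cauchy_ballP => e e0; rewrite near_map2.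
  have e'0 : 0 < re_scalar e / 2.
    by rewrite divr_gt0// -(ltr_of_real (k := k)) re_scalarK ?ltW// rmorph0.
  near=> n m; rewrite -ball_normE /ball_/=.
  rewrite -of_real_rnorm -(re_scalarK _ (ltW e0)) ltr_of_real.
  apply: le_lt_trans (uh n m) _; rewrite [ltRHS]splitr; apply: ltrD.
    by near: n; move/cvgr_lt: h0; apply.
  by near: m; move/cvgr_lt: h0; apply.
exists (lim (u @ \oo)); apply/cvgrPdist_lt => e e0.
have e'0 : 0 < of_real e :> scalars R k.
  by rewrite -(rmorph0 of_real) ltr_of_real.
move/cvgrPdist_lt: ucvg => /(_ _ e'0); apply: filterS => n.
by rewrite -of_real_rnorm ltr_of_real sub0r normrN ger0_norm// rnorm_ge0.
Unshelve. all: by end_near. Qed.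

End Completeness.

(** * Parallelogram law and Cauchy-Schwarz inequality *)

Section InnerProduct.
Context {R : realType} {k : scalar_kind} {X : hilbertType R k}.
Implicit Types x y : X.

Lemma hdotC x y : hdot x y = conj_scalar (hdot y x).
Proof. by rewrite hermC/= expr0 mul1r. Qed.

Lemma of_real_rnorm2 x : of_real (rnorm x ^+ 2) = hdot x x.
Proof. by rewrite rmorphXn/= of_real_rnorm hnormE. Qed.

Lemma rabs_hdotC x y : rabs (hdot x y) = rabs (hdot y x).
Proof. by rewrite hdotC rabs_conj. Qed.

Lemma parallelogram x y :
  rnorm (x + y) ^+ 2 + rnorm (x - y) ^+ 2 = 2 * (rnorm x ^+ 2 + rnorm y ^+ 2).
Proof.
apply: (@of_real_inj R k); rewrite rmorphM !rmorphD/= !of_real_rnorm2 rmorph1.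
rewrite !linearDl !linearDr/= !linearNl !linearNr/=; ring.
Qed.

(** Pythagoras for the component of [x] orthogonal to [y], multiplied by [rnorm y ^+ 2] so that
    [y = 0] is covered. *)
Lemma exists_orthogonal_shift x y : exists t : scalars R k,
  rnorm (x + t *: y) ^+ 2 * rnorm y ^+ 2 =
  rnorm x ^+ 2 * rnorm y ^+ 2 - rabs (hdot x y) ^+ 2.
Proof.
have [->|y0] := eqVneq y 0.
  by exists 0; rewrite linear0r rabs0 rnorm0 expr0n/= !mulr0 subrr.
exists (- (hdot x y / hdot y y)).
have N0 : hdot y y != 0 by rewrite -hnormE expf_neq0// normr_eq0.
apply: (@of_real_inj R k); rewrite [LHS]rmorphM rmorphB [X in X - _]rmorphM/=.
rewrite !of_real_rnorm2 rmorphXn/=.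
rewrite of_real_rabs -mulr_conj -(hdotC y x).
rewrite linearDl !linearDr/= !linearZl_LR !linearZr_LR/=.
rewrite rmorphN fmorph_div/= -!hdotC.
have expand (F : fieldType) (a b b' n : F) : n != 0 ->
    (a + - (b' / n) * b + (- (b / n) * b' + - (b' / n) * (- (b / n) * n))) * n =
    a * n - b * b' by move=> n0; field.
exact: expand.
Qed.

(** With [d = 0] this is Cauchy-Schwarz. With [d] the infimum of the squared norm, it makes
    near-minimizers nearly orthogonal to every admissible direction [y]. *)
Lemma ler_hdot_shift (d : R) x y :
  (forall t : scalars R k, d <= rnorm (x + t *: y) ^+ 2) ->
  rabs (hdot x y) ^+ 2 <= (rnorm x ^+ 2 - d) * rnorm y ^+ 2.
Proof.
move=> dle; have [t et] := exists_orthogonal_shift x y.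
have := ler_wpM2r (sqr_ge0 (rnorm y)) (dle t); rewrite et; lra.
Qed.

Lemma CauchySchwarz_hdot x y : rabs (hdot x y) <= rnorm x * rnorm y.
Proof.
rewrite -(@ler_pXn2r _ 2) ?nnegrE ?rabs_ge0 ?mulr_ge0 ?rnorm_ge0// exprMn.
rewrite -[in leRHS](subr0 (_ ^+ 2)); apply: ler_hdot_shift => t.
exact: sqr_ge0.
Qed.

End InnerProduct.

(** * Riesz representation along an operator *)

Section Riesz.
Context {R : realType} {k : scalar_kind}.

Lemma le0_of_cvg0 (a : nat -> R) (c r : R) : a @ \oo --> (0 : R) ->
  (forall n, r <= a n * c) -> r <= 0.
Proof.
move=> a0 ra; rewrite -(mul0r c).
have ac : (a n * c) @[n --> \oo] --> 0 * c by exact: cvgMl.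
rewrite -(cvg_lim _ ac)//; apply: limr_ge; last by near=> n.
by apply/cvg_ex; exists (0 * c).
Unshelve. all: by end_near. Qed.

(* The representing vector is a multiple of the limit of [T (u n)] for a
   sequence [u] in the hyperplane [f = 1] that minimizes the norm of [T (u n)];
   this limit is orthogonal to [T] of the kernel of [f]. *)
Lemma riesz_along (X : lmodType (scalars R k)) (Z : hilbertType R k)
    (T : {linear X -> Z}) (f : {scalar X}) (C : R) :
  (forall g, rabs (f g) <= C * rnorm (T g)) ->
  exists z, forall g, f g = hdot (T g) z.
Proof.
move=> fC; have [f0|/existsNP[g1 /eqP fg1]] := pselect (forall g, f g = 0).
  by exists 0 => g; rewrite f0 linear0r.
pose S := [set rnorm (T g) ^+ 2 | g in [set g | f g = 1]].
have infS : has_inf S.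
  split; last by exists 0 => _ [g _ <-]; exact: sqr_ge0.
  exists (rnorm (T ((f g1)^-1 *: g1)) ^+ 2), ((f g1)^-1 *: g1) => //=.
  by rewrite linearZ/= mulVf.
have Sinf g : f g = 1 -> inf S <= rnorm (T g) ^+ 2.
  by move=> fg; apply: ge_inf; [exact: infS.2|exists g].
pose h := @harmonic R.
have hgt0 n : 0 < h n by rewrite /h /harmonic/= invr_gt0.
(* The excess is a square so that taking roots leaves bounds linear in [h n]. *)
have /choice[u uP] n : exists g, f g = 1 /\ rnorm (T g) ^+ 2 < inf S + h n ^+ 2.
  by have [_ [g fg <-] ?] := inf_adherent (exprn_gt0 2 (hgt0 n)) infS; exists g.
have u1 n : f (u n) = 1 by case: (uP n).
have ulim n : rnorm (T (u n)) ^+ 2 - inf S <= h n ^+ 2.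
  by rewrite lerBlDl ltW//; case: (uP n).
have Tu_orth n g : f g = 0 -> rabs (hdot (T (u n)) (T g)) <= h n * rnorm (T g).
  move=> fg; rewrite -(@ler_pXn2r _ 2) ?nnegrE;
    rewrite ?rabs_ge0 ?mulr_ge0 ?rnorm_ge0 ?(ltW (hgt0 _))//.
  rewrite exprMn; apply: le_trans _ (ler_wpM2r (sqr_ge0 _) (ulim n)).
  apply: ler_hdot_shift => t; rewrite -linearZ -linearD; apply: Sinf.
  by rewrite linearD linearZ/= fg mulr0 addr0.
(* The midpoint of [u n] and [u m] still satisfies [f = 1], so its image has squared norm at least
   [inf S]; the parallelogram law then bounds the squared distance by
   [2 * (h n ^+ 2 + h m ^+ 2)]. *)
have Tu_cauchy n m : rnorm (T (u n) - T (u m)) <= 2 * h n + 2 * h m.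
  have fmid : f (2^-1 *: (u n + u m)) = 1.
    by rewrite linearZ linearD/= !u1 mulVf// pnatr_eq0.
  have rabs_half : rabs (2^-1 : scalars R k) = 2^-1.
    apply: (@of_real_inj R k).
    by rewrite of_real_rabs normfV normr_nat fmorphV rmorph_nat.
  rewrite -(@ler_pXn2r _ 2) ?nnegrE;
    rewrite ?addr_ge0 ?mulr_ge0 ?rnorm_ge0 ?(ltW (hgt0 _))//.
  have := parallelogram (T (u n)) (T (u m)).
  have := Sinf _ fmid; rewrite linearZ linearD rnormZ rabs_half.
  have := ulim n; have := ulim m; have := mulr_gt0 (hgt0 n) (hgt0 m).
  nra.
have h2cvg : (2 * h n) @[n --> \oo] --> (0 : R).
  by rewrite -(mulr0 2); apply: cvgMr; exact: cvg_harmonic.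
have [w wP] := cvg_of_rate _ _ h2cvg Tu_cauchy.
have w_orth g : f g = 0 -> hdot (T g) w = 0.
  move=> fg; apply/eqP; rewrite -rabs_le0 rabs_hdotC.
  have ah : (rnorm (w - T (u n)) + h n) @[n --> \oo] --> (0 : R).
    by rewrite -(addr0 0); apply: cvgD => //; exact: cvg_harmonic.
  apply: (le0_of_cvg0 _ (rnorm (T g)) _ ah) => n; rewrite mulrDl.
  rewrite -[w in leLHS](subrK (T (u n))) linearDl.
  by rewrite (le_trans (ler_rabsD _ _))// lerD ?CauchySchwarz_hdot ?Tu_orth.
(* Subtracting [f g *: u n] moves [g] into the kernel of [f], so [hdot (T g) w] is proportional to
   [f g]. *)
have Tw g n : hdot (T g) w = f g * hdot (T (u n)) w.
  have /w_orth : f (g - f g *: u n) = 0.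
    by rewrite linearB linearZ/= u1 mulr1 subrr.
  rewrite linearB linearZ/= linearBl linearZl_LR.
  by move=> /eqP; rewrite subr_eq0 => /eqP.
pose c := hdot (T (u 0%N)) w.
(* If [c] vanished, [w] would be orthogonal to the range of [T]; as a limit of points [T (u n)] of
   that range it would be 0. Then [T (u n)] would tend to 0, against [1 = rabs (f (u n)) <= C *
   rnorm (T (u n))]. *)
have c0 : c != 0.
  apply/eqP => c0; have Tw0 g : hdot (T g) w = 0.
    by rewrite (Tw g 0%N) -/c c0 mulr0.
  have w0 : w = 0.
    apply/eqP; rewrite -rnorm_le0.
    rewrite -(@ler_pXn2r _ 2) ?nnegrE ?rnorm_ge0// expr0n/=.
    apply: (le0_of_cvg0 _ (rnorm w) _ wP) => n.
    have -> : rnorm w ^+ 2 = rabs (hdot (w - T (u n)) w).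
      apply: (@of_real_inj R k); rewrite linearBl/= Tw0 subr0 of_real_rabs.
      by rewrite -hnormE rmorphXn/= of_real_rnorm ger0_norm ?exprn_ge0.
    exact: CauchySchwarz_hdot.
  suff : (1 : R) <= 0 by rewrite ler10.
  apply: (le0_of_cvg0 _ C _ wP) => n.
  by rewrite w0 sub0r rnormN mulrC -(@rabs1 R k) -(u1 n).
(* The scalar is conjugated because [hdot] is conjugate-linear in its second argument. *)
exists ((conj_scalar c)^-1 *: w) => g.
rewrite linearZr_LR/= fmorphV/= conj_scalarK.
by rewrite (Tw g 0%N) -/c mulrC mulfK.
Qed.
End Riesz.

(** * The adjoint and its range *)

Section Adjoint.
Context {R : realType} {k : scalar_kind} {X Y : hilbertType R k}.
Variable T : {linear X -> Y}.
Hypothesis boundedT : bounded_operator T.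

Lemma bounded_operator_gt0 :
  exists M : R, 0 < M /\ forall x, rnorm (T x) <= M * rnorm x.
Proof.
have [M TM] := boundedT; exists (Num.max M 1).
split=> [|x]; first by rewrite lt_max ltr01 orbT.
by rewrite (le_trans (TM x))// ler_wpM2r ?rnorm_ge0// le_max lexx.
Qed.

(** A representing vector exists by [riesz_along] for the identity operator, so [xget] does not
    return its default. *)
Lemma adjointP (y : Y) u : hdot (T u) y = hdot u (adjoint T y).
Proof.
suff ex : exists x, forall u, hdot (T u) y = hdot u x.
  exact: (@xgetPex _ 0 [set x | forall u, hdot (T u) y = hdot u x] ex).
pose f u := hdot (T u) y.
have f_scalar : scalar f by move=> a v w; rewrite /f linearP linearPl.
pose fL := GRing.isLinear.Build _ _ _ _ f f_scalar.
pose F : {scalar X} := HB.pack f fL.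
have [M [M0 TM]] := bounded_operator_gt0.
apply: (riesz_along _ _ idfun F (M * rnorm y)) => g /=.
rewrite (le_trans (CauchySchwarz_hdot _ _))// mulrAC.
by rewrite ler_wpM2r ?rnorm_ge0.
Qed.

Lemma adjoint_eq (y : Y) (x : X) :
  (forall u, hdot (T u) y = hdot u x) -> adjoint T y = x.
Proof.
move=> Tyx; apply/eqP; rewrite -subr_eq0 -normr_eq0 -sqrf_eq0 hnormE.
by rewrite linearBr/= -adjointP Tyx subrr.
Qed.

(** Cauchy-Schwarz gives the bound from a preimage [y], with [C = rnorm y]. Conversely, Riesz along
    [T] applied to the functional [hdot ^~ phi] yields the preimage. *)
Lemma range_adjointP (phi : X) :
  range (adjoint T) phi <->
  exists C : R, forall g, rabs (hdot g phi) <= C * rnorm (T g).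
Proof.
split=> [[y _ <-]|[C phiC]].
  exists (rnorm y) => g.
  by rewrite -adjointP mulrC CauchySchwarz_hdot.
have f_scalar : scalar (fun g => hdot g phi) by move=> a v w; rewrite linearPl.
pose fL := GRing.isLinear.Build _ _ _ _ _ f_scalar.
pose F : {scalar X} := HB.pack (fun g => hdot g phi) fL.
have [z Tz] := riesz_along _ _ T F C phiC.
by exists z => //; apply: adjoint_eq => u; rewrite -Tz.
Qed.

End Adjoint.

(** * Positivity of the infimum and range membership *)

Section InfTest.
Context {R : realType} {k : scalar_kind}.

Lemma inf_test_gt0P (X : hilbertType R k) (K : X -> R) (chi : set X) (phi : X) :
  (0 < inf_test K chi phi)%E <->
  exists2 m : R, 0 < m & forall h, chi h -> m <= K (hat phi + h).
Proof.
split=> [|[m m0 mK]].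
  have lbK h : chi h -> (inf_test K chi phi <= (K (hat phi + h))%:E)%E.
    by move=> chih; apply: ereal_inf_lbound; exists h.
  case: (inf_test K chi phi) lbK => [r| |] lbK //=.
    by rewrite lte_fin => r0; exists r => // h /lbK; rewrite lee_fin.
  (* An infimum equal to [+oo] forces [chi] to be empty, since the values of [K] are real. *)
  by exists 1 => // h /lbK; rewrite leye_eq.
apply: (@lt_le_trans _ _ m%:E); first by rewrite lte_fin.
by apply: le_ereal_inf_tmp => _ [h chih <-]; rewrite lee_fin mK.
Qed.

Lemma hdot_hat (X : hilbertType R k) (phi : X) : phi != 0 ->
  hdot (hat phi) phi = `|phi|.
Proof.
move=> phi0; rewrite /hat linearZl_LR/= -hnormE expr2 mulKf//.
by rewrite normr_eq0.
Qed.

(** The free exponent [n.+1] lets one argument serve both tests: the first power of [rnorm (Q g)]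
    for [K0], the fourth for [K1]. *)
Lemma range_adjoint_inf_test (X Z : hilbertType R k) (Q : {linear X -> Z})
    (K : X -> R) (a b : R) (n : nat) (phi : X) :
  bounded_operator Q -> 0 < a -> 0 < b ->
  (forall g, a * rnorm (Q g) ^+ n.+1 <= K g <= b * rnorm (Q g) ^+ n.+1) ->
  phi != 0 ->
  range (adjoint Q) phi <->
  (forall chi : set X, chi `<=` orth phi -> (0 < inf_test K chi phi)%E).
Proof.
move=> bQ a0 b0 KQ phi0; rewrite (range_adjointP _ bQ).
have nphi0 : 0 < rnorm phi by rewrite rnorm_gt0.
split=> [[C phiC] chi chiphi|/(_ (orth phi) (@subset_refl _ _))].
  apply/inf_test_gt0P.
  have C0 h : chi h -> rnorm phi <= C * rnorm (Q (hat phi + h)).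
    move=> /chiphi hphi; apply: le_trans (phiC (hat phi + h)).
    by rewrite linearDl/= hdot_hat// hphi addr0 /rabs normr_id.
  (* [C] is not assumed positive, and the lower bound divides by it. *)
  pose C' := Num.max C 1.
  have C'0 : 0 < C' by rewrite lt_max ltr01 orbT.
  exists (a * (rnorm phi / C') ^+ n.+1);
    first by rewrite mulr_gt0 ?exprn_gt0 ?divr_gt0.
  move=> h /C0 hC; have /andP[+ _] := KQ (hat phi + h); apply: le_trans.
  rewrite ler_pM2l// ler_pXn2r ?nnegrE ?divr_ge0 ?rnorm_ge0 ?(ltW C'0)//.
  rewrite ler_pdivrMr// mulrC (le_trans hC)// ler_wpM2r ?rnorm_ge0//.
  by rewrite le_max lexx.
move=> /inf_test_gt0P[m m0 mK].
(* This avoids roots: a norm below 1 dominates its power [n.+1], hence is at least [m / b]; any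
   other norm is at least 1. *)
pose s := Num.min 1 (m / b).
have s0 : 0 < s by rewrite lt_min ltr01 divr_gt0.
have sQ h : orth phi h -> s <= rnorm (Q (hat phi + h)).
  move=> /mK; have /andP[_ +] := KQ (hat phi + h) => /[swap] /le_trans /[apply].
  rewrite mulrC -ler_pdivrMr// ge_min => mQ.
  have [//|Q1] /= := leP 1 (rnorm (Q (hat phi + h))).
  apply: (le_trans mQ); rewrite exprS.
  by rewrite ler_piMr ?rnorm_ge0// exprn_ile1 ?rnorm_ge0 ?ltW.
exists (rnorm phi / s) => g.
have [->|gphi] := eqVneq (hdot g phi) 0.
  by rewrite rabs0 mulr_ge0 ?divr_ge0 ?rnorm_ge0 ?(ltW s0).
have absphi0 : `|phi| != 0 by rewrite normr_eq0.
(* Dividing [g] by [t] places it on the affine hyperplane [hat phi + orth phi], where [sQ]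
   applies. *)
pose t := hdot g phi / `|phi|.
have t0 : t != 0 by rewrite mulf_neq0 ?invr_eq0.
pose h := t^-1 *: g - hat phi.
have gE : g = t *: (hat phi + h) by rewrite addrC subrK scalerA divff// scale1r.
have h_orth : orth phi h.
  rewrite /orth/= linearBl linearZl_LR/= hdot_hat// /t invfM invrK.
  by rewrite mulrAC mulVf// mul1r subrr.
have -> : rabs (hdot g phi) = rabs t * rnorm phi.
  rewrite -(divfK absphi0 (hdot g phi)) -/t rabsM.
  by rewrite /rnorm [in LHS]/rabs normr_id.
rewrite gE linearZ rnormZ mulrCA -[leLHS]mulr1 -mulrA.
rewrite ler_wpM2l ?rabs_ge0// mulr1 -mulrA ler_peMr ?rnorm_ge0//.
by rewrite mulrC ler_pdivlMr// mul1r sQ.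
Qed.

End InfTest.

(** * The two factorizations *)

Theorem corollary3 (R : realType) (k : scalar_kind) (X Y Z : hilbertType R k) :
  (forall (L : {linear X -> Y}) (P : {linear Z -> Y}) (Q : {linear X -> Z}),
     bounded_operator L -> bounded_operator P -> bounded_operator Q ->
     (forall g, L g = P (Q g)) ->
     (exists c : R, 0 < c /\ forall z, c * rnorm z <= rnorm (P z)) ->
     forall phi : X, phi != 0 ->
       range (adjoint Q) phi <->
       (forall chi : set X, chi `<=` orth phi ->
          (0 < inf_test (K0 L) chi phi)%E))
  /\
  (forall (L : {linear X -> X}) (Q : {linear X -> Z}) (A : {linear Z -> Z}),
     bounded_operator L -> bounded_operator Q -> bounded_operator A ->
     (forall g, L g = adjoint Q (A (Q g))) ->
     (exists c : R, 0 < c /\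
        forall z, range Q z -> c * rnorm z ^+ 2 <= rabs (hdot z (A z))) ->
     forall phi : X, phi != 0 ->
       range (adjoint Q) phi <->
       (forall chi : set X, chi `<=` orth phi ->
          (0 < inf_test (K1 L) chi phi)%E)).
Proof.
split=> [L P Q _ bP bQ LPQ [c [c0 cP]]|L Q A bL bQ bA LQAQ [c [c0 cA]]]
  phi phi0.
  have [M [M0 PM]] := bounded_operator_gt0 P bP.
  apply: (range_adjoint_inf_test _ _ Q (K0 L) c M 0) => // g.
  by rewrite expr1 /K0 LPQ cP PM.
have [M [M0 AM]] := bounded_operator_gt0 A bA.
(* [K1] squares a quantity lying between [c] and [M] times [rnorm (Q g) ^+ 2], whence the squared
   constants and the exponent 4. *)
apply: (range_adjoint_inf_test _ _ Q (K1 L) (c ^+ 2) (M ^+ 2) 3);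
  rewrite ?exprn_gt0// => g.
(* Both adjoints are moved across the inner product; the order of its arguments does not affect the
   modulus. *)
have -> : K1 L g = rabs (hdot (Q g) (A (Q g))) ^+ 2.
  by rewrite /K1 rabs_hdotC -adjointP// rabs_hdotC LQAQ -adjointP.
rewrite (exprM _ 2 2) -!exprMn.
rewrite !ler_pXn2r ?nnegrE ?mulr_ge0 ?rabs_ge0 ?rnorm_ge0 ?(ltW c0) ?(ltW M0)//.
rewrite cA; last by exists g.
rewrite (le_trans (CauchySchwarz_hdot _ _))// mulrC expr2 mulrA.
by rewrite ler_wpM2r ?rnorm_ge0.
Qed.
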